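(* Let $1\le n<m$, $q\in\mathbb C\setminus\{0\}$, and let $A=(a_{ij})_{m\times m}$ be a $q$-right-quantum matrix, i.e. $$a_{jk}a_{ik}=q\,a_{ik}a_{jk}\ (i<j),\qquad a_{ik}a_{jl}-q^{-1}a_{jk}a_{il}=a_{jl}a_{ik}-q\,a_{il}a_{jk}\ (i<j,\ k<l).$$ For $n<i,j\le m$ let $$c^q_{ij}=-{\det}_q^{-1}(I-A_0)\cdot{\det}_q\begin{pmatrix} I-A_0 & -a_{*j}\\ -a_{i*} & -a_{ij}\end{pmatrix},\qquad C^q=(c^q_{ij})_{n+1\le i,j\le m}.$$ Then ${\det}_q^{-1}(I-A_0)\cdot{\det}_q(I-A)={\det}_q(I-C^q)$.
   Context: $\mathcal A$ is the $\mathbb C$-algebra of formal power series in non-commuting variables $a_{ij}$, $1\le i,j\le m$; identities are in the quotient by the closed two-sided ideal generated by the stated relations. $A_0=(a_{ij})_{1\le i,j\le n}$, $a_{i*}=(a_{i1},\dots,a_{in})$, $a_{*j}=(a_{1j},\dots,a_{nj})^T$. For words $\lambda,\mu$ over $\{1,\dots,m\}$, $a_{\lambda,\mu}=a_{\lambda_1\mu_1}\cdots a_{\lambda_\ell\mu_\ell}$, $\operatorname{inv}$ is the number of inversions, and $w(\lambda,\mu)=q^{\operatorname{inv}\mu-\operatorname{inv}\lambda}$. For a square matrix $B=(b_{rs})_{N\times N}$ with row labels $\rho_1<\dots<\rho_N$ and column labels $\kappa_1<\dots<\kappa_N$ in $\{1,\dots,m\}$ and entries linear combinations of $1$ and $a_{\rho_r\kappa_s}$,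 ${\det}_qB$ is obtained by expanding $\sum_{\sigma\in S_N}(-1)^{\operatorname{inv}\sigma}b_{\sigma(1)1}\cdots b_{\sigma(N)N}$ into words $a_{\lambda,\mu}$ ($\lambda$ row labels, $\mu$ column labels) and multiplying each by $w(\lambda,\mu)$; this applies to $I-A$, $I-A_0$ and the bordered matrix with rows labelled $1,\dots,n,i$ and columns $1,\dots,n,j$. ${\det}_q^{-1}(I-A_0)$ is the inverse of ${\det}_q(I-A_0)$. ${\det}_q(I-C^q)=\sum_{J\subseteq\{n+1,\dots,m\}}(-1)^{|J|}\sum_{\sigma\in S_J}(-q)^{-\operatorname{inv}\sigma}c^q_{\sigma(j_1)j_1}\cdots c^q_{\sigma(j_k)j_k}$ ($J=\{j_1<\dots<j_k\}$), treating the $c^q_{ij}$ as letters. *)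

(* Defs.v *)
From HB Require Import structures.
From mathcomp Require Import all_boot all_order all_fingroup all_algebra.
From mathcomp Require Import boolp classical_sets reals.
From mathcomp Require Export complex.

Set Implicit Arguments.
Unset Strict Implicit.
Unset Printing Implicit Defensive.

Import GRing.Theory.
Local Open Scope ring_scope.

(* A series is identified with its family of coefficients, indexed by the
   words (finite sequences) in the variables [L]. *)
Record ncseries (K : fieldType) (L : Type) := NCSeries { coef :> seq L -> K }.

Section Series.
Variables (K : fieldType) (L : Type).
Local Notation series := (ncseries K L).
Implicit Types (f g h : series) (w : seq L).

Lemma ncseriesP f g : (forall w, f w = g w) <-> f = g.
Proof.
split=> [|-> //]; case: f g => [f] [g] /= fg.
by congr NCSeries; apply: funext.
Qed.

HB.instance Definition _ := gen_eqMixin series.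
HB.instance Definition _ := gen_choiceMixin series.

Definition nc0 : series := NCSeries (fun=> 0).
Definition ncadd f g : series := NCSeries (fun w => f w + g w).
Definition ncopp f : series := NCSeries (fun w => - f w).
Definition ncscale (a : K) f : series := NCSeries (fun w => a * f w).
Definition nc1 : series := NCSeries (fun w => (nilp w)%:R).

(* Product of series: sum over all factorisations of [w] into two words. *)
Definition ncmul f g : series :=
  NCSeries (fun w => \sum_(k < (size w).+1) f (take k w) * g (drop k w)).

Fact ncaddA : associative ncadd.
Proof. by move=> f g h; apply/ncseriesP => w /=; rewrite addrA. Qed.
Fact ncaddC : commutative ncadd.
Proof. by move=> f g; apply/ncseriesP => w /=; rewrite addrC. Qed.
Fact ncadd0 : left_id nc0 ncadd.
Proof. by move=> f; apply/ncseriesP => w /=; rewrite add0r. Qed.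
Fact ncaddN : left_inverse nc0 ncopp ncadd.
Proof. by move=> f; apply/ncseriesP => w /=; rewrite addNr. Qed.

HB.instance Definition _ :=
  GRing.isZmodule.Build series ncaddA ncaddC ncadd0 ncaddN.

Lemma ncmul_nil f g : ncmul f g [::] = f [::] * g [::].
Proof. by rewrite /= big_ord_recl big_ord0 addr0. Qed.

Let tl (x : L) f : series := NCSeries (fun w => f (x :: w)).

Lemma ncmul_cons f g x w :
  ncmul f g (x :: w) = f [::] * g (x :: w) + ncmul (tl x f) g w.
Proof. by rewrite /= big_ord_recl. Qed.

Fact ncmulDl : left_distributive ncmul +%R.
Proof.
move=> f g h; apply/ncseriesP => w /=; rewrite -big_split /=.
by apply: eq_bigr => k _; rewrite mulrDl.
Qed.

Fact ncmulDr : right_distributive ncmul +%R.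
Proof.
move=> f g h; apply/ncseriesP => w /=; rewrite -big_split /=.
by apply: eq_bigr => k _; rewrite mulrDr.
Qed.

Fact ncscaleAl a f g : ncscale a (ncmul f g) = ncmul (ncscale a f) g.
Proof.
apply/ncseriesP => w /=; rewrite mulr_sumr.
by apply: eq_bigr => k _; rewrite mulrA.
Qed.

Fact ncscaleAr a f g : ncscale a (ncmul f g) = ncmul f (ncscale a g).
Proof.
apply/ncseriesP => w /=; rewrite mulr_sumr.
by apply: eq_bigr => k _; rewrite mulrCA.
Qed.

Fact ncmulA : associative ncmul.
Proof.
move=> f g h; apply/ncseriesP => w; elim: w f => [|x w IHw] f.
  by rewrite !ncmul_nil mulrA.
rewrite !ncmul_cons IHw ncmul_nil.
suff -> : tl x (ncmul f g) = ncscale (f [::]) (tl x g) + ncmul (tl x f) g.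
  by rewrite ncmulDl -ncscaleAl /= mulrDr mulrA addrA.
by apply/ncseriesP => v; rewrite [LHS]ncmul_cons.
Qed.

Fact ncmul1 : left_id nc1 ncmul.
Proof.
move=> f; apply/ncseriesP => -[|x w]; first by rewrite ncmul_nil mul1r.
rewrite ncmul_cons mul1r /= big1 ?addr0 // => k _.
by rewrite mul0r.
Qed.

Fact ncmulr1 : right_id nc1 ncmul.
Proof.
move=> f; apply/ncseriesP => w; elim: w f => [|x w IHw] f.
  by rewrite ncmul_nil mulr1.
by rewrite ncmul_cons mulr0 add0r IHw.
Qed.

Fact nc1_neq0 : nc1 != 0.
Proof.
apply/eqP => /(congr1 (fun f : series => f [::])) /= /eqP.
by rewrite oner_eq0.
Qed.

HB.instance Definition _ := GRing.Zmodule_isNzRing.Build series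
  ncmulA ncmul1 ncmulr1 ncmulDl ncmulDr nc1_neq0.

Fact ncscaleA a b f : ncscale a (ncscale b f) = ncscale (a * b) f.
Proof. by apply/ncseriesP => w /=; rewrite mulrA. Qed.
Fact ncscale1 : left_id 1 ncscale.
Proof. by move=> f; apply/ncseriesP => w /=; rewrite mul1r. Qed.
Fact ncscaleDr : right_distributive ncscale +%R.
Proof. by move=> a f g; apply/ncseriesP => w /=; rewrite mulrDr. Qed.
Fact ncscaleDl f : {morph ncscale^~ f : a b / a + b}.
Proof. by move=> a b; apply/ncseriesP => w /=; rewrite mulrDl. Qed.

HB.instance Definition _ := GRing.Zmodule_isLmodule.Build K series
  ncscaleA ncscale1 ncscaleDr ncscaleDl.
HB.instance Definition _ := GRing.Lmodule_isLalgebra.Build K series ncscaleAl.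
HB.instance Definition _ := GRing.Lalgebra_isAlgebra.Build K series ncscaleAr.

(* The right inverse of a series with nonzero constant term, computed by
   recursion on the length of the words; [N] is any bound on this length. *)
Fixpoint ncinv_rec (N : nat) f w : K :=
  if N isn't N'.+1 then (f [::])^-1 else
  if w is x :: w' then
    - (f [::])^-1 *
      \sum_(k < size w) f (take k.+1 w) * ncinv_rec N' f (drop k.+1 w)
  else (f [::])^-1.

Definition ncunit f : bool := f [::] != 0.

Definition ncinv f : series :=
  if ncunit f then NCSeries (fun w => ncinv_rec (size w) f w) else f.

Lemma ncinv_rec_stable N f w :
  (size w <= N)%N -> ncinv_rec N f w = ncinv_rec (size w) f w.
Proof.
have [M] := ubnP (size w); elim: M w N => // M IHM [|x w] [|N] //= wM wN.
congr (_ * _); apply: eq_bigr => k _; congr (_ * _).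
have kw : (size (drop k w) <= size w)%N by rewrite size_drop leq_subr.
have kM : (size (drop k w) < M)%N by apply: leq_ltn_trans kw _.
by rewrite IHM ?[RHS]IHM // (leq_trans kw).
Qed.

Fact ncmulV f : ncunit f -> f * ncinv f = 1.
Proof.
move=> uf; apply/ncseriesP => -[|x w]; rewrite /ncinv uf.
  by rewrite [LHS]ncmul_nil /= divff.
rewrite [LHS]ncmul_cons /= mulrA mulrN divff // mulN1r.
apply/eqP; rewrite addrC subr_eq0; apply/eqP.
apply: eq_bigr => k _ /=; rewrite [in RHS]ncinv_rec_stable //.
by rewrite size_drop leq_subr.
Qed.

Fact ncunitV f : ncunit f -> ncunit (ncinv f).
Proof. by move=> uf; rewrite /ncinv uf /ncunit /= invr_eq0. Qed.

Fact ncmulVr : {in ncunit, left_inverse 1 ncinv *%R}.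
Proof.
move=> f uf; have gh := ncmulV (ncunitV uf).
by rewrite -[in X in _ * X](mulr1 f) -gh [f * _]mulrA (ncmulV uf) mul1r.
Qed.

Fact ncdivrr : {in ncunit, right_inverse 1 ncinv *%R}.
Proof. by move=> f /ncmulV. Qed.

Fact ncunitP f g : g * f = 1 /\ f * g = 1 -> ncunit f.
Proof.
case=> _ /(congr1 (fun h : series => h [::])); rewrite [LHS]ncmul_nil /= => fg.
by apply/eqP => f0; move/eqP: fg; rewrite f0 mul0r eq_sym oner_eq0.
Qed.

Fact ncinv_out : {in [predC ncunit], ncinv =1 id}.
Proof. by move=> f /negbTE uf; rewrite /ncinv ifF. Qed.

HB.instance Definition _ := GRing.NzRing_hasMulInverse.Build series
  ncmulVr ncdivrr ncunitP ncinv_out.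

Definition two_sided_ideal (I : set series) : Prop :=
  [/\ I 0, forall f g, I f -> I g -> I (f + g)
    & forall u f v, I f -> I (u * f * v)].

(* Closed for the topology of formal power series, in which a sequence
   converges when its terms agree with the limit on longer and longer words. *)
Definition ncclosed (I : set series) : Prop :=
  forall f, (forall N : nat, exists2 g, I g &
    forall w, (size w < N)%N -> f w = g w) -> I f.

Definition closed_ideal_generated (S : set series) : set series :=
  [set f | forall I : set series,
             two_sided_ideal I -> ncclosed I -> (S `<=` I)%classic -> I f].

(* Equality in the quotient of the series by this ideal. *)
Definition eq_modulo (S : set series) f g : Prop :=
  closed_ideal_generated S (f - g).

End Series.

Definition ncvar (K : fieldType) (L : eqType) (x : L) : ncseries K L :=
  NCSeries (fun w => (w == [:: x])%:R).

(* The labels 1, ..., m are encoded by 0, ..., m.-1 in 'I_m. *)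
Fixpoint inv_word (m : nat) (s : seq 'I_m) : nat :=
  if s is x :: s' then (count (fun y : 'I_m => y < x)%N s' + inv_word s')%N
  else 0%N.

Section QDet.
Variables (K : fieldType) (m : nat).

(* The letter (i, j) stands for a_ij: the word w is a_{lambda,mu} with
   lambda = unzip1 w and mu = unzip2 w. *)
Local Notation series := (ncseries K ('I_m * 'I_m)%type).

Definition gen_mx : 'M[series]_m := \matrix_(i, j) ncvar K (i, j).

(* Multiplication of each word a_{lambda,mu} by w(lambda,mu). *)
Definition qweight (q : K) (f : series) : series :=
  NCSeries (fun w =>
    q ^ ((inv_word (unzip2 w))%:Z - (inv_word (unzip1 w))%:Z) * f w).

(* The letters carry their own row and column labels, so the labels of B need
   not be recorded. *)
Definition qdet (q : K) (N : nat) (B : 'M[series]_N) : series :=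
  qweight q (\sum_(s : 'S_N)
    (-1) ^+ inv_word [seq s k | k <- enum 'I_N] * \prod_(k < N) B (s k) k).

Definition right_quantum_relations (q : K) : set series :=
  let a i j : series := gen_mx i j in
  [set f | (exists i j k : 'I_m,
              (i < j)%N /\ f = a j k * a i k - q *: (a i k * a j k))
        \/ (exists i j k l : 'I_m,
              [/\ (i < j)%N, (k < l)%N
                & f = (a i k * a j l - q^-1 *: (a j k * a i l))
                    - (a j l * a i k - q *: (a i l * a j k))])].

Section Sylvester.
Variables (q : K) (n : nat) (le_nm : (n <= m)%N).

Definition A0_mx : 'M[series]_n :=
  \matrix_(i, j) gen_mx (widen_ord le_nm i) (widen_ord le_nm j).

(* The inverse of det_q (I - A_0) used below is thus a genuine one. *)
Fact qdet_one_minus_A0_unit : qdet q (1%:M - A0_mx) \is a GRing.unit.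
Proof.
pose c0 (f : series) := f [::].
have c0D : {morph c0 : f g / f + g} by [].
have c0M : {morph c0 : f g / f * g} by move=> f g; exact: ncmul_nil.
have c0X f k : c0 (f ^+ k) = c0 f ^+ k.
  by elim: k => // k IHk; rewrite !exprS c0M IHk.
have c0B i j : c0 ((1%:M - A0_mx) i j) = (i == j)%:R.
  by rewrite !mxE c0D /= subr0; case: eqP.
have c0N1 : c0 (-1) = -1 by [].
rewrite unfold_in /= /ncunit /= expr0z mul1r -[X in X != 0]/(c0 _).
rewrite (big_morph c0 c0D (erefl _)) (bigD1 1%g) //.
rewrite [X in _ + X != 0]big1 => [|s s1]; last first.
  have [k sk] : exists k, s k != k.
    apply/existsP; apply: contraNT s1; rewrite negb_exists => /forallP sE.
    by apply/eqP/permP => k; rewrite perm1; apply/eqP; rewrite -[_ == _]negbK.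
  rewrite c0M (big_morph c0 c0M (erefl _)) (bigD1 k) //= c0B (negbTE sk).
  by rewrite mul0r mulr0.
rewrite addr0 c0M c0X c0N1 (big_morph c0 c0M (erefl _)) mulf_neq0 //.
  by rewrite signr_eq0.
by rewrite big1 ?oner_eq0 // => k _; rewrite c0B perm1 eqxx.
Qed.

Definition bordered_mx (i j : 'I_m) : 'M[series]_(n + 1) :=
  block_mx (1%:M - A0_mx) (- \col_k gen_mx (widen_ord le_nm k) j)
           (- \row_k gen_mx i (widen_ord le_nm k)) (- (gen_mx i j)%:M).

(* Only the entries whose labels are both > n (n <= i, j in 'I_m) are part of
   the matrix C^q. *)
Definition cq (i j : 'I_m) : series :=
  - ((qdet q (1%:M - A0_mx))^-1 * qdet q (bordered_mx i j)).

End Sylvester.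

(* det_q (I - C) for C = (c i j) with labels n < i, j <= m; S_J consists of
   the permutations of 'I_m with support in J, and enum J lists J in increasing
   order. *)
Definition qdet_one_minus (q : K) (n : nat) (c : 'I_m -> 'I_m -> series) :
    series :=
  \sum_(J : {set 'I_m} | J \subset [set j : 'I_m | (n <= j)%N])
    (-1) ^+ #|J| *
    \sum_(s : 'S_m | perm_on J s)
      (- q) ^- inv_word [seq s j | j <- enum J] *:
        \prod_(j <- enum J) c (s j) j.

End QDet.

(* Main.v *)
(* Gaussian elimination one label at a time. Let r be the smallest label of A_0,
   u = 1 - a_rr, and a'_xk = a_xk + q^-1 u^-1 a_xr a_rk, which is c^q for
   A_0 = (a_rr). For index sets I, J of larger labels the q-minors satisfy
     D_a(I, J) - D_a(r I, r J) = u D_a'(I, J),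
   by induction on J, the correction term being an alternating sum that
   vanishes by the right-quantum relations. Hence a' is again right-quantum,
   and, as det_q(I - a) is the alternating sum of the principal q-minors of a,
   it equals u det_q(I - a'); likewise for bordered determinants, so that a and
   a' have the same c^q, and induction on the size of A_0 gives the theorem.
   This takes place in an algebra where series without constant term become
   elements x with 1 - x invertible, namely the quotient by the ideal. *)
Require Import Defs.
From HB Require Import structures.
From mathcomp Require Import all_boot all_order all_fingroup all_algebra.
From mathcomp Require Import reals boolp.
Set Implicit Arguments.
Unset Strict Implicit.
Unset Printing Implicit Defensive.

Import GRing.Theory.
Local Open Scope ring_scope.

(** * Sums over the subsequences of a list *)

Section SubsequenceSums.
Variables (I : Type) (V : nmodType).

(** The recursion on the list, in place of a sum over subsets, lets the elimination of the head
    label, or the choice of a term in one diagonal entry, split off one summand. *)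
Fixpoint subseq_sum (f : seq I -> V) (s : seq I) : V :=
  if s is x :: s' then subseq_sum f s' + subseq_sum (fun w => f (x :: w)) s'
  else f [::].

Lemma subseq_sum_cons f x s :
  subseq_sum f (x :: s) = subseq_sum f s + subseq_sum (fun w => f (x :: w)) s.
Proof. by []. Qed.

Lemma subseq_sumD f g s :
  subseq_sum f s + subseq_sum g s = subseq_sum (fun w => f w + g w) s.
Proof. by elim: s f g => //= x s IHs f g; rewrite addrACA !IHs. Qed.

End SubsequenceSums.

Lemma eq_subseq_sum (I : eqType) (V : nmodType) (f g : seq I -> V) (s : seq I) :
  (forall w, {subset w <= s} -> f w = g w) -> subseq_sum f s = subseq_sum g s.
Proof.
elim: s f g => /= [|x s IHs] f g fg; first exact: fg.
congr (_ + _); apply: IHs => w ws; apply: fg => y; rewrite !inE.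
  by move=> /ws->; rewrite orbT.
by case/predU1P => [->|/ws->]; rewrite ?eqxx ?orbT.
Qed.

Lemma mulr_subseq_sum (I : Type) (B : pzSemiRingType) (f : seq I -> B) u s :
  u * subseq_sum f s = subseq_sum (fun w => u * f w) s.
Proof. by elim: s f => //= x s IHs f; rewrite mulrDr !IHs. Qed.

(** * q-minors and their expansion along the first column *)

Section QMinor.
Variables (K : fieldType) (A : algType K) (m : nat) (q : K).
Hypothesis q_neq0 : q != 0.
Implicit Types (a c : 'I_m -> 'I_m -> A) (S : {set 'I_m}) (J L w : seq 'I_m).
Local Notation p := (q^-1).

(** For [x] in [S], this is the number of inversions that [x] creates at the head of a word listing
    [S]. *)
Definition before S (x : 'I_m) : nat := #|[set y in S | (y < x)%N]|.

(* For increasing J this is the sum of (-q)^{-inv lambda} a_{lambda,J} over the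
   words lambda listing the set S, expanded along the first column. *)
Fixpoint qminor a S J : A :=
  if J is j :: J' then
    \sum_(x in S) (- p) ^+ before S x *: (a x j * qminor a (S :\ x) J')
  else (S == set0)%:R.

Lemma qminor_cons a S j J : qminor a S (j :: J) =
  \sum_(x in S) (- p) ^+ before S x *: (a x j * qminor a (S :\ x) J).
Proof. by []. Qed.

Lemma eq_qminor a c S J :
  (forall x j, x \in S -> j \in J -> a x j = c x j) -> qminor a S J = qminor c S J.
Proof.
elim: J S => //= j J IHJ S ac; apply: eq_bigr => x xS.
rewrite ac ?mem_head //; congr (_ *: (_ * _)); apply: IHJ => y k.
by rewrite in_setD1 => /andP[_ yS] kJ; rewrite ac // inE kJ orbT.
Qed.

Lemma before_rem_lt S (x y : 'I_m) : (y < x)%N -> before (S :\ x) y = before S y.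
Proof.
move=> yx; congr #|pred_of_set _|; apply/setP => z; rewrite !inE.
by case: eqP => // ->; rewrite [(x < y)%N]ltnNge ltnW ?andbF.
Qed.

Lemma before_rem_gt S (x y : 'I_m) :
  (y < x)%N -> y \in S -> before S x = (before (S :\ y) x).+1.
Proof.
move=> yx yS; rewrite /before (cardsD1 y) !inE yS yx; congr _.+1.
by congr #|pred_of_set _|; apply/setP => z; rewrite !inE andbA.
Qed.

(** Each pair of distinct rows occurs in both orders, with the same remaining set and with exponents
    of [- p] that differ by one. The hypothesis on [c] makes the two terms cancel. *)
Lemma alternating_sum_eq0 c S (X : {set 'I_m} -> A) :
    (forall x y : 'I_m, x \in S -> y \in S -> (x < y)%N -> c x y = p *: c y x) ->
  \sum_(x in S) (- p) ^+ before S x *: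
    \sum_(y in S :\ x) (- p) ^+ before (S :\ x) y *:
      (c x y * X (S :\ x :\ y)) = 0.
Proof.
move=> cP.
pose T x y := (- p) ^+ (before S x + before (S :\ x) y) *:
      (c x y * X (S :\ x :\ y)).
have -> : \sum_(x in S) (- p) ^+ before S x *:
    \sum_(y in S :\ x) (- p) ^+ before (S :\ x) y *:
      (c x y * X (S :\ x :\ y)) =
    \sum_(x in S) \sum_(y in S | (y < x)%N) (T x y + T y x).
  transitivity (\sum_(x in S) (\sum_(y in S | (y < x)%N) T x y +
                    \sum_(y in S | (x < y)%N) T x y)).
    apply: eq_bigr => x xS; rewrite scaler_sumr.
    rewrite (bigID (fun y : 'I_m => (y < x)%N)) /=.
    congr (_ + _); apply: eq_big => [y|y _]; rewrite ?scalerA -?exprD //.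
      rewrite !inE; case: (ltnP y x) => yx; rewrite ?andbF // !andbT.
      by rewrite -val_eqE /= neq_ltn yx.
    rewrite !inE -leqNgt; case: (ltngtP x y) => [xy|yx|/val_inj->];
      rewrite ?andbF ?eqxx // !andbT.
    by rewrite -val_eqE /= neq_ltn xy orbT.
  rewrite [LHS]big_split; rewrite [X in _ + X = _](exchange_big_dep (mem S)) /=;
    last by move=> x y _ /andP[].
  rewrite -big_split; apply: eq_bigr => x xS /=.
  rewrite [RHS]big_split; congr (_ + _); apply: eq_bigl => y; by rewrite xS.
rewrite big1 // => x xS; rewrite big1 // => y /andP[yS yx].
rewrite /T before_rem_lt // (before_rem_gt yx) //.
rewrite [X in c y x * X](_ : _ = X (S :\ x :\ y)).
    rewrite (cP _ _ yS xS yx) -scalerAl scalerA.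
    by rewrite -scalerDl addSn [(before S y + _)%N]addnC exprS mulNr mulrC addNr scale0r.
by congr X; apply/setP => z; rewrite !inE andbCA.
Qed.

Lemma before_min S (r x : 'I_m) :
    (r < x)%N -> r \notin S -> before (r |: S) x = (before S x).+1.
Proof.
by move=> rx rS; rewrite (@before_rem_gt _ x r) ?setU1K // setU11.
Qed.

(** Since [r] precedes all of [S], it creates no inversion at the head of a word, while any other
    first letter [x] has one more inversion than in [S], namely with [r]. *)
Lemma qminor_min a S (r j : 'I_m) J : (forall x, x \in S -> (r < x)%N) ->
  qminor a (r |: S) (j :: J) = a r j * qminor a S J -
    p *: \sum_(x in S) (- p) ^+ before S x *:
           (a x j * qminor a (r |: (S :\ x)) J).
Proof.
move=> rS; have rnS : r \notin S by apply/negP => /rS; rewrite ltnn.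
rewrite /= big_setU1 //= setU1K //; congr (_ + _).
  rewrite (_ : before _ _ = 0%N) ?scale1r //.
  apply: eq_card0 => y; rewrite !inE; case: eqP => [->|_]; first by rewrite ltnn.
  by case yS: (y \in S) => //=; rewrite ltnNge ltnW // rS.
rewrite scaler_sumr -sumrN; apply: eq_bigr => x xS.
rewrite before_min ?rS // exprS -scaleNr scalerA; congr (_ *: (_ * qminor _ _ _)).
by apply/setP => y; rewrite !inE; case: (eqVneq y r) => [->|]; rewrite ?andbF //;
   rewrite andbT; apply: contraNneq rnS => ->.
Qed.

Lemma qminor_set2 a (x y k l : 'I_m) : (x < y)%N ->
  qminor a [set x; y] [:: k; l] = a x k * a y l - p *: (a y k * a x l).
Proof.
move=> xy; rewrite qminor_min => [|z]; last by rewrite inE => /eqP->.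
have q1 z i : qminor a [set z] [:: i] = a z i.
  rewrite /= big_set1 setDv eqxx mulr1 (_ : before _ _ = 0%N) ?scale1r //.
  by apply: eq_card0 => w; rewrite !inE; case: eqP => // ->; rewrite ltnn.
rewrite q1 big_set1 setDv setU0 q1 (_ : before _ _ = 0%N) ?scale1r //.
by apply: eq_card0 => w; rewrite !inE; case: eqP => // ->; rewrite ltnn.
Qed.

(** The relations are expressed by two-row minors whose columns may be equal or decreasing, because
    [qminor_elim] carries such minors over to the eliminated matrix. *)
Definition right_quantum a (T : {set 'I_m}) : Prop :=
  forall S : {set 'I_m}, S \subset T -> #|S| = 2 ->
    (forall k, k \in T -> qminor a S [:: k; k] = 0) /\
    (forall k l : 'I_m, k \in T -> l \in T -> (k < l)%N ->
       qminor a S [:: k; l] = - q *: qminor a S [:: l; k]).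

(** * Elimination of the smallest label *)

Section Elimination.
Variables (a : 'I_m -> 'I_m -> A) (T : {set 'I_m}) (r : 'I_m) (v w : A).
Hypotheses (rT : forall x, x \in T -> (r < x)%N)
  (aq : right_quantum a (r |: T)).
Hypotheses (vl : v * (1 - a r r) = 1) (vr : (1 - a r r) * v = 1)
  (wl : w * (1 - q *: a r r) = 1).

Definition elim_mx x k : A := a x k + p *: (v * a x r * a r k).

Let rq2 (x y k : 'I_m) : x \in r |: T -> y \in r |: T -> k \in r |: T ->
  (x < y)%N -> a x k * a y k = p *: (a y k * a x k).
Proof.
move=> xT yT kT xy; have [||/(_ k kT) + _] := @aq [set x; y].
- by rewrite subUset !sub1set xT.
- by rewrite cards2 -val_eqE neq_ltn xy.
by rewrite qminor_set2 // => /subr0_eq.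
Qed.

Let rq4 (x y k l : 'I_m) : x \in r |: T -> y \in r |: T -> k \in r |: T ->
    l \in r |: T -> (x < y)%N -> (k < l)%N ->
  a x k * a y l - p *: (a y k * a x l) = a y l * a x k - q *: (a x l * a y k).
Proof.
move=> xT yT kT lT xy kl; have [||_ /(_ k l kT lT kl)] := @aq [set x; y].
- by rewrite subUset !sub1set xT.
- by rewrite cards2 -val_eqE neq_ltn xy.
rewrite !qminor_set2 // => ->; rewrite scaleNr scalerBr opprB scalerA.
by rewrite divff // scale1r.
Qed.

Let inr x : x \in T -> x \in r |: T. Proof. by move=> xT; rewrite setU1r. Qed.

(** The relation for rows [r], [x] and columns [r], [k] rewrites [elim_mx x k] as [v] times an
    element in which [a x k * (1 - a r r)] occurs; the right factor [v] then cancels [1 - a r r]. *)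
Lemma elim_mulv x k : x \in T -> k \in T ->
  elim_mx x k * v = v * (a x k + q *: (a r k * a x r * v)).
Proof.
move=> xT kT.
have := rq4 (setU11 r T) (inr xT) (setU11 r T) (inr kT) (rT xT) (rT kT).
set t := a r r; set e := a x k; set b := a x r; set d := a r k => E.
have -> : elim_mx x k = v * (e + q *: (d * b) - e * t).
  have -> : e + q *: (d * b) - e * t = (1 - t) * e + p *: (b * d).
    rewrite mulrBl mul1r -!addrA; congr (_ + _).
    by rewrite -[LHS]opprB -E opprB addrC.
  by rewrite mulrDr mulrA vl mul1r -scalerAr mulrA.
rewrite -mulrA; congr (_ * _); rewrite addrAC mulrDl -scalerAl; congr (_ + _).
by rewrite -{1}[e]mulr1 -mulrBr -mulrA vr mulr1.
Qed.

(** Entries of column [r] commute with [a r r] up to the factor [q], so that [a z r * v = w * a z r]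
    with [w] the inverse of [1 - q *: a r r]. What remains is the relation within column [r]. *)
Lemma mul_conj_v x y : x \in T -> y \in T -> (x < y)%N ->
  a x r * v * a y r = p *: (a y r * v * a x r).
Proof.
move=> xT yT xy.
have bv z : z \in T -> a z r * v = w * a z r.
  move=> zT; rewrite -[w * _]mulr1 -vr mulrA; congr (_ * v).
  rewrite -[LHS]mul1r -[X in X * _ = _]wl -!mulrA; congr (_ * _).
  rewrite mulrBl mulrBr mul1r mulr1; congr (_ - _); rewrite -scalerAl.
  rewrite (rq2 _ _ _ (rT zT)) ?setU11 ?inr //.
  by rewrite scalerA divff // scale1r.
rewrite !bv // -!mulrA (rq2 _ _ _ xy) ?setU11 ?inr //.
by rewrite -scalerAr.
Qed.

(** This is the hypothesis of [alternating_sum_eq0] for the correction term below. With [v] moved to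
    the left, the terms with a second [v] match by [mul_conj_v], and the others by the relation for
    rows [x], [y] and columns [r], [j]. *)
Lemma elim_alternating j x y : j \in T -> x \in T -> y \in T -> (x < y)%N ->
  elim_mx x j * v * a y r + p *: (v * a x r * a y j) =
    p *: (elim_mx y j * v * a x r + p *: (v * a y r * a x j)).
Proof.
move=> jT xT yT xy; rewrite !elim_mulv //.
have E := rq4 (inr xT) (inr yT) (setU11 r T) (inr jT) xy (rT jT).
rewrite -!mulrA [p *: (v * (a x r * _))]scalerAr [p *: (v * (a y r * _))]scalerAr.
rewrite -!mulrDr [p *: (v * _)]scalerAr; congr (_ * _).
rewrite !mulrDl -!scalerAl -!mulrA.
have -> : a x r * (v * a y r) = p *: (a y r * (v * a x r)).
  by rewrite !mulrA mul_conj_v.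
rewrite -scalerAr [q *: (p *: _)]scalerA [q * p]mulrC -scalerA 2!scalerDr.
rewrite addrAC [RHS]addrAC; congr (_ + _).
have: p *: (a x r * a y j - p *: (a y r * a x j)) =
  p *: (a y j * a x r - q *: (a x j * a y r)) by rewrite E.
rewrite !scalerBr !scalerA mulVf // scale1r => /eqP.
by rewrite subr_eq addrAC eq_sym subr_eq eq_sym => /eqP <-; rewrite addrC.
Qed.

Lemma qminor_elim_mx S J : S \subset T -> {subset J <= T} ->
  qminor elim_mx S J = qminor a S J + p *: (v *
    \sum_(x in S) (- p) ^+ before S x *: (a x r * qminor a (r |: (S :\ x)) J)).
Proof.
elim: J S => [|j J IHJ] S ST JT.
  rewrite [X in v * X]big1 ?mulr0 ?scaler0 ?addr0 // => x _ /=.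
  by rewrite setU_eq0 -cards_eq0 cards1 mulr0 scaler0.
have jT : j \in T by rewrite JT ?mem_head.
have JT' : {subset J <= T} by move=> k kJ; rewrite JT // inE kJ orbT.
(* The first product arises from the induction hypothesis for [J]; the second cancels the sum that
   [qminor_min] produces. *)
pose c x y := elim_mx x j * v * a y r + p *: (v * a x r * a y j).
pose X S := qminor a (r |: S) J.
have alt : \sum_(x in S) (- p) ^+ before S x *:
    \sum_(y in S :\ x) (- p) ^+ before (S :\ x) y *:
      (c x y * X (S :\ x :\ y)) = 0.
  apply: alternating_sum_eq0 => x y xS yS xy.
  by apply: elim_alternating => //; apply: (subsetP ST).
rewrite [LHS]/= [qminor a S _]/= mulr_sumr scaler_sumr.
(* The vanishing sum [alt], multiplied by [p], is added on the right; then the two sides agree for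
   each first row [x] separately. *)
rewrite -[RHS]addr0 [X in _ = _ + X](esym (scaler0 _ p)) -[in X in _ = _ + X]alt.
rewrite [X in _ = _ + X]scaler_sumr -!big_split.
apply: eq_bigr => x xS; cbv beta.
have SxT : S :\ x \subset T by apply: subset_trans ST; apply: subD1set.
rewrite IHJ // qminor_min => [|y ySx]; last by apply: rT; apply: (subsetP SxT).
set Q := qminor a (S :\ x) J.
pose Y i := \sum_(y in S :\ x) (- p) ^+ before (S :\ x) y *:
              (a y i * X (S :\ x :\ y)).
rewrite -/(Y r) -/(Y j).
have -> : \sum_(y in S :\ x) (- p) ^+ before (S :\ x) y *:
    (c x y * X (S :\ x :\ y)) = elim_mx x j * v * Y r + p *: (v * a x r * Y j).
  rewrite /Y !mulr_sumr scaler_sumr -big_split; apply: eq_bigr => y _ /=.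
  rewrite -!scalerAr scalerA [p * _]mulrC -scalerA -scalerDr /c; congr (_ *: _).
  by rewrite mulrDl -scalerAl !mulrA.
rewrite /= -[v * (_ ^+ _ *: _)]scalerAr.
set e := (- p) ^+ _; have pC (u : A) : p *: (e *: u) = e *: (p *: u).
  by rewrite !scalerA mulrC.
rewrite !pC -!scalerDr; congr (_ *: _).
rewrite mulrDr -scalerAr [p *: (_ + _)]scalerDr !mulrA.
rewrite [LHS]addrC [RHS]addrCA; congr (_ + _).
rewrite {1}/elim_mx mulrDl -addrA; congr (_ + _).
by rewrite -scalerAl -scalerDr mulrBr -scalerAr !mulrA subrK.
Qed.

(** The correction sum is what the expansion of [qminor a (r |: S) (r :: J)] leaves after its
    leading term [a r r * qminor a S J]. *)
Lemma qminor_elim S J : S \subset T -> {subset J <= T} ->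
  (1 - a r r) * qminor elim_mx S J = qminor a S J - qminor a (r |: S) (r :: J).
Proof.
move=> ST JT; rewrite qminor_elim_mx // qminor_min => [|x xS]; last first.
  by apply: rT; apply: (subsetP ST).
by rewrite mulrDr -scalerAr mulrA vr mul1r mulrBl mul1r opprB -addrA [- _ + _]addrC.
Qed.

(** A two-row minor of [elim_mx] is [v] times a two-row minor of [a] minus a three-row one with
    first column [r]. Expanding the latter along that column leaves two-row minors in the two given
    columns, to which the relations of [a] apply. *)
Lemma right_quantum_elim : right_quantum elim_mx T.
Proof.
have elimE S J : S \subset T -> {subset J <= T} ->
    qminor elim_mx S J = v * (qminor a S J - qminor a (r |: S) (r :: J)).
  by move=> ST JT; rewrite -qminor_elim // mulrA vl mul1r.
have sub2 k l : k \in T -> l \in T -> {subset [:: k; l] <= T}.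
  by move=> kT lT z; rewrite !inE => /orP[]/eqP->.
move=> S ST S2; have rS : r \notin S.
  by apply/negP => /(subsetP ST)/rT; rewrite ltnn.
have ST' : r |: S \subset r |: T by apply: setUS.
have aqx x : x \in r |: S -> (r |: S) :\ x \subset r |: T /\ #|(r |: S) :\ x| = 2.
  move=> xS; split; first by apply: subset_trans ST'; apply: subD1set.
  by have := cardsD1 x (r |: S); rewrite xS cardsU1 rS S2 => /addnI <-.
have [aq0 aqS] := aq (subset_trans ST (subsetUr _ _)) S2; split=> [k kT|k l kT lT kl].
  rewrite elimE //; last exact: sub2.
  rewrite aq0 ?inr // qminor_cons big1 ?subr0 ?mulr0 // => x xS.
  by have [xT x2] := aqx _ xS; have [-> //] := aq xT x2; rewrite ?inr ?mulr0 ?scaler0.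
rewrite !elimE //; try exact: sub2.
rewrite aqS ?inr // scalerAr scalerBr; congr (v * (_ - _)).
rewrite !qminor_cons scaler_sumr; apply: eq_bigr => x xS.
have [xT x2] := aqx _ xS; have [_ ->] := aq xT x2; rewrite ?inr //.
by rewrite -scalerAr !scalerA mulrC.
Qed.

End Elimination.

(* For a list L of labels, det_q (I - a) on L and minus the determinant
   bordered by row i and column j. *)
Definition principal_sum a L : A :=
  subseq_sum (fun w => (-1) ^+ size w * qminor a [set x in w] w) L.

Definition bordered_sum a L i j : A :=
  subseq_sum (fun w =>
    (-1) ^+ size w * qminor a [set x in rcons w i] (rcons w j)) L.

Lemma mulr_sign_comm (x y : A) k : x * ((-1) ^+ k * y) = (-1) ^+ k * (x * y).
Proof. by rewrite mulrA (commr_sign x k) mulrA. Qed.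

Lemma before_set1 x : before [set x] x = 0%N.
Proof. by apply: eq_card0 => y; rewrite !inE; case: eqP => // ->; rewrite ltnn. Qed.

Lemma set_nil : [set x in [::]] = set0 :> {set 'I_m}.
Proof. by apply/setP => x; rewrite !inE. Qed.

(** * The identity in an algebra, by induction on the eliminated labels *)

Section Sylvester.
(** [N] stands for the elements without constant term. Its closure properties keep the entries in
    [N], and hence the pivots invertible, after each elimination. *)
Variable N : A -> Prop.
Hypotheses (ND : forall x y, N x -> N y -> N (x + y))
  (NM : forall x y, N y -> N (x * y))
  (Ninv : forall x, N x -> exists v, v * (1 - x) = 1 /\ (1 - x) * v = 1).

Let NZ k x : N x -> N (k *: x).
Proof. by move=> Nx; rewrite -[x]mul1r scalerAl; apply: NM. Qed.

Local Notation ltI := (fun x y : 'I_m => (x < y)%N).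

(** Eliminating the head of [L0] takes the same factor [1 - a r r] out of the principal and the
    bordered sums, so [c] stays fixed throughout the induction. When [L0] is empty, the equation for
    [c] says that it agrees with [a] on [L1]. *)
Theorem q_sylvester a c L0 L1 :
    sorted ltI (L0 ++ L1) ->
    right_quantum a [set x in L0 ++ L1] ->
    (forall i j, i \in L0 ++ L1 -> j \in L0 ++ L1 -> N (a i j)) ->
    (forall i j, i \in L1 -> j \in L1 ->
       principal_sum a L0 * c i j = bordered_sum a L0 i j) ->
  principal_sum a (L0 ++ L1) = principal_sum a L0 * principal_sum c L1.
Proof.
elim: L0 a => [|r L0 IHL] a sL aq aN ac.
  have cE i j : i \in L1 -> j \in L1 -> c i j = a i j.
    move=> iL jL; have := ac i j iL jL; rewrite /principal_sum /bordered_sum /=.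
    rewrite !mul1r set_nil eqxx mul1r => ->.
    rewrite set_cons set_nil setU0 big_set1 before_set1 setDv eqxx.
    by rewrite mulr1 scale1r.
  rewrite {2}/principal_sum /= set_nil eqxx !mul1r.
  apply: eq_subseq_sum => w wL; congr (_ * _); apply: eq_qminor => x k.
  by rewrite inE => /wL xL /wL kL; rewrite cE.
have /andP[/allP rL sL'] : all (ltI r) (L0 ++ L1) && sorted ltI (L0 ++ L1).
  by rewrite -path_sortedE // => x y z; apply: ltn_trans.
have aqT : right_quantum a (r |: [set x in L0 ++ L1]) by rewrite -set_cons.
have rT x : x \in [set x in L0 ++ L1] -> (r < x)%N by rewrite inE => /rL.
have Nt : N (a r r) by apply: aN; apply: mem_head.
(* The second inverse [w] serves to move [v] past the entries of column [r]. *)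
have [v [vl vr]] := Ninv Nt; have [w [wl _]] := Ninv (NZ q Nt).
have elimP (S J : seq 'I_m) : {subset S <= L0 ++ L1} -> {subset J <= L0 ++ L1} ->
    (1 - a r r) * qminor (elim_mx a r v) [set x in S] J =
    qminor a [set x in S] J - qminor a (r |: [set x in S]) (r :: J).
  move=> SL JL; apply: (qminor_elim rT aqT vl vr wl).
    by apply/subsetP => x; rewrite !inE => /SL.
  by move=> x /JL; rewrite inE.
have prinE L : {subset L <= L0 ++ L1} ->
    principal_sum a (r :: L) = (1 - a r r) * principal_sum (elim_mx a r v) L.
  (* The subsequences [s] and [r :: s] occur with opposite signs, and [elimP] evaluates the
     difference of their minors. *)
  move=> LL; rewrite /principal_sum subseq_sum_cons subseq_sumD mulr_subseq_sum.
  apply: eq_subseq_sum => s sL0.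
  have sLL x : x \in s -> x \in L0 ++ L1 by move=> /sL0/LL.
  rewrite mulr_sign_comm elimP // mulrBr exprS mulN1r mulNr set_cons //.
rewrite prinE //; last by move=> x; rewrite mem_cat => ->.
rewrite [LHS]prinE // IHL ?mulrA //.
- exact: (right_quantum_elim rT aqT vl vr wl).
- move=> i j iL jL; apply: ND; first by apply: aN; rewrite inE ?iL ?jL orbT.
  by apply/NZ/NM; apply: aN; rewrite inE ?eqxx ?jL ?orbT.
(* The factor [v * (1 - a r r)] is inserted on both sides to return from the eliminated matrix to
   [a], where the equation for [c] is known. *)
move=> i j iL jL; rewrite -[LHS]mul1r -vl -!mulrA; rewrite [(1 - _) * _]mulrA.
rewrite -prinE; last by move=> x; rewrite mem_cat => ->.
rewrite ac // -[RHS]mul1r -[X in _ = X * _]vl -mulrA; congr (_ * _).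
rewrite /bordered_sum subseq_sum_cons subseq_sumD.
rewrite mulr_subseq_sum; apply: eq_subseq_sum => s sL0.
rewrite mulr_sign_comm elimP.
- by rewrite mulrBr exprS mulN1r mulNr set_cons.
- by move=> x; rewrite mem_rcons inE mem_cat => /predU1P[->|/sL0->//]; rewrite iL orbT.
- by move=> x; rewrite mem_rcons inE mem_cat => /predU1P[->|/sL0->//]; rewrite jL orbT.
Qed.

End Sylvester.

End QMinor.

(** * The quotient of an algebra by a proper two-sided ideal *)

Section QuotientAlgebra.
Variables (K : fieldType) (B : algType K) (J : B -> Prop).
Hypotheses (J0 : J 0) (JD : forall x y, J x -> J y -> J (x + y))
  (JM : forall u x v, J x -> J (u * x * v)) (J1 : ~ J 1).

Definition ideal_mem : {pred B} := fun x => `[< J x >].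

Let JP x : reflect (J x) (x \in ideal_mem). Proof. exact: asboolP. Qed.

Let ideal_zmod_closed : zmod_closed ideal_mem.
Proof.
split=> [|x y /JP Jx /JP Jy]; apply/JP => //; apply: JD => //.
by rewrite -[y]mulr1 -mulNr -mulN1r; apply: JM.
Qed.

HB.instance Definition _ := GRing.isZmodClosed.Build B ideal_mem ideal_zmod_closed.

Local Notation I := (ideal_mem : zmodClosed B).

Let I1 : 1 \notin I. Proof. exact/JP. Qed.

Let IM x u v : x \in I -> u * x * v \in I.
Proof. by move=> /JP Jx; apply/JP/JM. Qed.

(* The library puts a ring structure on {quot I} for commutative rings only. *)
Definition quotient_carrier : Type := Quotient.quot I.
HB.instance Definition _ :=
  GRing.Zmodule.copy quotient_carrier (Quotient.quot I).
Local Notation Q := quotient_carrier.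
Let rep : Q -> B := @generic_quotient.repr _ (Quotient.quot I).
Let pi (x : B) : Q := \pi_(Quotient.quot I)%qT x.

Let piP x y : pi x = pi y <-> x - y \in I.
Proof.
by rewrite (Quotient.idealrBE I x y); split => [/eqP|/eqP].
Qed.

Let piK x : pi (rep x) = x. Proof. exact: reprK. Qed.

Let piD x y : pi (x + y) = pi x + pi y. Proof. by rewrite /pi !piE. Qed.

Let qmul (x y : Q) : Q := pi (rep x * rep y).
Let qscale k (x : Q) : Q := pi (k *: rep x).

(** Replacing the factors by their representatives one at a time changes the product by elements of
    the ideal. *)
Let piM x y : pi (x * y) = qmul (pi x) (pi y).
Proof.
have Irepr z : z - rep (pi z) \in I by apply/piP; rewrite piK.
apply/piP; rewrite -(subrK (rep (pi x) * y) (x * y)) -addrA rpredD //.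
  by rewrite -mulrBl -[_ * y]mul1r mulrA IM.
by rewrite -mulrBr -[_ * _]mulr1 IM.
Qed.

Let piZ k x : pi (k *: x) = qscale k (pi x).
Proof.
apply/piP; rewrite -scalerBr -[_ - _]mul1r scalerAl -[_ * _]mulr1 IM //.
by apply/piP; rewrite piK.
Qed.

Let qmulA : associative qmul.
Proof. by move=> x y z; rewrite -[x]piK -[y]piK -[z]piK -!piM mulrA. Qed.
Let qmul1 : left_id (pi 1) qmul.
Proof. by move=> x; rewrite -[x]piK -!piM mul1r. Qed.
Let qmulr1 : right_id (pi 1) qmul.
Proof. by move=> x; rewrite -[x]piK -!piM mulr1. Qed.
Let qmulDl : left_distributive qmul +%R.
Proof.
by move=> x y z; rewrite -[x]piK -[y]piK -[z]piK -piD -!piM -piD mulrDl.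
Qed.
Let qmulDr : right_distributive qmul +%R.
Proof.
by move=> x y z; rewrite -[x]piK -[y]piK -[z]piK -piD -!piM -piD mulrDr.
Qed.
Let pi0 : pi 0 = 0. Proof. by rewrite /pi !piE. Qed.
Let q1_neq0 : pi 1 != 0.
Proof. by apply: contra I1; rewrite -pi0 => /eqP/piP; rewrite subr0. Qed.

HB.instance Definition _ := GRing.Zmodule_isNzRing.Build Q
  qmulA qmul1 qmulr1 qmulDl qmulDr q1_neq0.

Let qscaleA k l x : qscale k (qscale l x) = qscale (k * l) x.
Proof. by rewrite -[x]piK -!piZ scalerA. Qed.
Let qscale1 : left_id 1 qscale.
Proof. by move=> x; rewrite -[x]piK -piZ scale1r. Qed.
Let qscaleDr : right_distributive qscale +%R.
Proof. by move=> k x y; rewrite -[x]piK -[y]piK -piD -!piZ -piD scalerDr. Qed.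
Let qscaleDl x : {morph qscale^~ x : k l / k + l}.
Proof. by move=> k l; rewrite -[x]piK -!piZ -piD scalerDl. Qed.

HB.instance Definition _ := GRing.Zmodule_isLmodule.Build K Q
  qscaleA qscale1 qscaleDr qscaleDl.

Let qscaleAl (k : K) (x y : Q) : k *: (x * y) = k *: x * y.
Proof.
rewrite -[x]piK -[y]piK -[LHS]/(qscale _ (qmul _ _)) -[RHS]/(qmul (qscale _ _) _).
by rewrite -piM -!piZ -piM scalerAl.
Qed.
Let qscaleAr (k : K) (x y : Q) : k *: (x * y) = x * (k *: y).
Proof.
rewrite -[x]piK -[y]piK -[LHS]/(qscale _ (qmul _ _)) -[RHS]/(qmul _ (qscale _ _)).
by rewrite -piM -!piZ -piM scalerAr.
Qed.

HB.instance Definition _ := GRing.Lmodule_isLalgebra.Build K Q qscaleAl.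
HB.instance Definition _ := GRing.Lalgebra_isAlgebra.Build K Q qscaleAr.

Let pi_zmod : zmod_morphism pi.
Proof. by move=> x y; rewrite /pi !piE. Qed.
Let pi_monoid : monoid_morphism pi.
Proof. by split=> // x y; rewrite piM. Qed.
Let pi_scalable : scalable pi.
Proof. by move=> k x; rewrite piZ. Qed.

HB.instance Definition _ := GRing.isZmodMorphism.Build B Q pi pi_zmod.
HB.instance Definition _ := GRing.isMonoidMorphism.Build B Q pi pi_monoid.
HB.instance Definition _ := GRing.isScalable.Build K B Q *:%R pi pi_scalable.

(** Equality modulo the ideal becomes equality in [P]; surjectivity allows elements of [P] to be
    lifted and their constant terms inspected. *)
Lemma quotient_algebra : exists (P : algType K) (f : {lrmorphism B -> P}),
  (forall x, f x = 0 <-> J x) /\ (forall y, exists x, f x = y).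
Proof.
exists Q, pi; split=> [x|y]; last by exists (rep y); apply: piK.
by have := piP x 0; rewrite pi0 subr0 => E; split => [/E/JP|/JP/E].
Qed.

End QuotientAlgebra.

(** * Permutations with given support and the parity of their inversions *)

Lemma perm_on_eqP (T : finType) (S : {set T}) (s t : {perm T}) :
  perm_on S s -> perm_on S t -> {in S, s =1 t} -> s = t.
Proof.
move=> sS tS st; apply/permP => x; have [/st//|xS] := boolP (x \in S).
by rewrite (out_perm sS xS) (out_perm tS xS).
Qed.

(** Serves the diagonal terms 1 of a determinant: taking the 1 in column [k] forces [s k = k] and
    leaves a permutation of the other labels. *)
Lemma perm_on_fix (T : finType) (S : {set T}) (s : {perm T}) k :
  k \notin S -> perm_on (k |: S) s && (s k == k) = perm_on S s.
Proof.
move=> kS; apply/andP/idP => [[/subsetP sS /eqP sk]|sS].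
  apply/subsetP => x sx; have := sS x sx; rewrite !inE => /predU1P[xk|//].
  by rewrite inE /= xk sk eqxx in sx.
split; last by rewrite (out_perm sS kS).
by apply: subset_trans sS (subsetUr _ _).
Qed.

Section InversionParity.
Variable m : nat.
Implicit Types (w t : seq 'I_m) (S : {set 'I_m}).
Local Notation ltI := (fun x y : 'I_m => (x < y)%N).

Lemma inv_word_insert t1 k t2 :
  inv_word (t1 ++ k :: t2) =
  (inv_word (t1 ++ t2) +
    (count (fun x : 'I_m => k < x)%N t1 + count (fun x : 'I_m => x < k)%N t2))%N.
Proof.
elim: t1 => [|x t1 IHt] /=; first by rewrite add0n addnC.
rewrite IHt !count_cat /= -!addnA; congr (_ + _)%N.
by rewrite addnCA; congr (_ + _)%N; rewrite addnCA.
Qed.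

Lemma inv_word_sorted w : sorted ltI w -> inv_word w = 0%N.
Proof.
elim: w => //= x w IHw; rewrite path_sortedE; last by move=> y z t; apply: ltn_trans.
case/andP=> /allP xw /IHw->; rewrite addn0; apply/eqP.
rewrite -leqn0 leqNgt -has_count -all_predC; apply/allP => y /xw xy.
by rewrite /= ltnNge ltnW // negbK.
Qed.

Lemma inv_word_map (n : nat) (h : 'I_n -> 'I_m) (u : seq 'I_n) :
  {mono h : x y / (x < y)%N} -> inv_word (map h u) = inv_word u.
Proof.
move=> hm; elim: u => //= x u ->; rewrite count_map; congr (_ + _)%N.
by apply: eq_count => y /=; rewrite hm.
Qed.

Lemma perm_eq_map_perm_on w (s : 'S_m) :
  uniq w -> perm_on [set x in w] s -> perm_eq (map s w) w.
Proof.
move=> uw sw; apply: uniq_perm => [||x]; rewrite ?(map_inj_uniq (@perm_inj _ _)) //.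
have sE y : (s y \in w) = (y \in w) by have := perm_closed y sw; rewrite !inE.
by rewrite -[x](permKV s) mem_map ?sE //; apply: perm_inj.
Qed.

(* As many larger values precede the fixed point k as smaller values follow. *)
Lemma sign_inv_word_fix w1 k w2 (s : 'S_m) :
    sorted ltI (w1 ++ k :: w2) -> perm_on [set x in w1 ++ k :: w2] s -> s k = k ->
  odd (inv_word (map s (w1 ++ k :: w2))) = odd (inv_word (map s (w1 ++ w2))).
Proof.
move=> sw sS sk.
have tr : transitive ltI by move=> y x z; apply: ltn_trans.
have uw : uniq (w1 ++ k :: w2) by apply: (sorted_uniq tr) sw => x; rewrite /= ltnn.
have pe := perm_eq_map_perm_on uw sS.
have [lt1 gt2] : all (fun x : 'I_m => x < k)%N w1 /\ all (fun x : 'I_m => k < x)%N w2.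
  move: sw; rewrite sorted_pairwise // pairwise_cat /= => /and4P[/allrelP w1k _ w2k _].
  by split=> //; apply/allP => x xw; apply: w1k; rewrite ?mem_head.
(* The values of [s] are a rearrangement of the labels, and the labels below [k] are those in
   [w1]. *)
have c1 : (count (fun x : 'I_m => x < k)%N (map s w1) +
          count (fun x : 'I_m => x < k)%N (map s w2))%N = size w1.
  have := seq.permP pe (fun x : 'I_m => x < k)%N.
  rewrite map_cat !count_cat /= sk ltnn !add0n => ->.
  have /eqP -> : count (fun x : 'I_m => x < k)%N w1 == size w1 by rewrite -all_count.
  rewrite (eq_in_count (a2 := pred0)) ?count_pred0 ?addn0 // => x.
  by move/(allP gt2) => kx /=; rewrite ltnNge ltnW.
have c2 : (count (fun x : 'I_m => x < k)%N (map s w1) +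
          count (fun x : 'I_m => k < x)%N (map s w1))%N = size w1.
  rewrite -(size_map s w1) -(count_predC (fun x : 'I_m => x < k)%N (map s w1)).
  congr (_ + _)%N; apply: eq_in_count => _ /mapP[x xw ->] /=.
  rewrite ltn_neqAle -leqNgt -[X in (_ != X)]/(val (s x)).
  rewrite -[X in (X != _)]/(val k) val_eqE -{1}sk (inj_eq perm_inj).
  by have := allP lt1 x xw; case: eqP => // ->; rewrite ltnn.
rewrite !map_cat /= sk inv_word_insert -map_cat oddD.
by rewrite (addnI (etrans c1 (esym c2))) addnn odd_double addbF.
Qed.

End InversionParity.

(** * q-minors as sums over words and over permutations *)

Section Permutations.
Variables (K : fieldType) (A : algType K) (m : nat) (q : K).
Implicit Types (g : 'I_m -> 'I_m -> A) (S : {set 'I_m}) (w J : seq 'I_m).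
Local Notation p := (q^-1).

Lemma permutations_enum_cons S : S != set0 ->
  perm_eq (permutations (enum S))
          [seq x :: t | x <- enum S, t <- permutations (enum (S :\ x))].
Proof.
move=> S0; apply: uniq_perm => [||t]; first exact: permutations_uniq.
  apply: allpairs_uniq_dep => [|x _|]; rewrite ?enum_uniq ?permutations_uniq //.
  by case=> x t [y u] _ _ /= [-> ->].
have remE x : x \in S -> perm_eq (x :: enum (S :\ x)) (enum S).
  move=> xS; apply: uniq_perm; rewrite /= ?enum_uniq ?mem_enum ?setD11 // => y.
  by rewrite inE !mem_enum !inE; case: eqP => // ->; rewrite xS.
rewrite mem_permutations; apply/idP/allpairsPdep => [tS|[x [u [xS uS ->]]]].
  case: t tS => [|x t] tS.
    by move: S0; rewrite -cards_eq0 cardE -(perm_size tS).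
  have xS : x \in S by rewrite -mem_enum -(perm_mem tS) mem_head.
  exists x, t; rewrite mem_enum mem_permutations; split=> //.
  by rewrite -(perm_cons x) (perm_trans tS) // perm_sym remE.
rewrite mem_enum in xS; apply: perm_trans (remE x xS).
by rewrite perm_cons -mem_permutations.
Qed.

Lemma qminor_permutations g S J : size J = #|S| ->
  qminor q g S J = \sum_(t <- permutations (enum S))
    (- p) ^+ inv_word t *: \prod_(x <- zip t J) g x.1 x.2.
Proof.
elim: J S => [|j J IHJ] S /= sJ.
  have /eqP S0 : S == set0 by rewrite -cards_eq0 -sJ.
  rewrite S0 eqxx enum_set0 (_ : permutations [::] = [:: [::]]) // big_seq1 /=.
  by rewrite big_nil scale1r.
have S0 : S != set0 by rewrite -cards_eq0 -sJ.
rewrite (perm_big _ (permutations_enum_cons S0)) /= big_allpairs_dep big_enum /=.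
apply: eq_bigr => x xS.
have cS : #|S| = (#|S :\ x|).+1 by rewrite (cardsD1 x S) xS.
rewrite IHJ; last by move: sJ; rewrite cS => -[].
rewrite mulr_sumr scaler_sumr big_seq [RHS]big_seq; apply: eq_bigr => t.
rewrite mem_permutations => tS; rewrite /= big_cons -scalerAr scalerA -exprD.
congr (_ ^+ (_ + _) *: _); rewrite (seq.permP tS) -size_filter.
rewrite -(card_uniqP (filter_uniq _ (enum_uniq _))); apply: eq_card => y.
rewrite inE [RHS]mem_filter mem_enum !inE; case: (ltnP y x) => yx; rewrite ?andbF // andbT.
by case: eqP yx => // ->; rewrite ltnn.
Qed.

(** The words listing the set are the images of [w] under the permutations supported there: distinct
    permutations give distinct words, and both families have the factorial of [#|S|] members. *)
Lemma qminor_perm g w : uniq w ->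
  qminor q g [set x in w] w = \sum_(s : 'S_m | perm_on [set x in w] s)
    (- p) ^+ inv_word (map s w) *: \prod_(j <- w) g (s j) j.
Proof.
move=> uw; set S := [set x in w].
have sw : size w = #|S| by rewrite cardsE; apply/esym/card_uniqP.
rewrite qminor_permutations //.
have pS : perm_eq [seq map s w | s : 'S_m <- enum (perm_on S)] (permutations (enum S)).
  have Sw : perm_eq (enum S) w.
    by apply: uniq_perm; rewrite ?enum_uniq // => x; rewrite mem_enum inE.
  have u1 : uniq [seq map s w | s : 'S_m <- enum (perm_on S)].
    rewrite map_inj_in_uniq ?enum_uniq // => s t; rewrite !mem_enum => sS tS st.
    apply: (perm_on_eqP sS tS) => x; rewrite inE => xw.
    by move/eq_in_map: st => /(_ x xw).
  have sub : {subset [seq map s w | s : 'S_m <- enum (perm_on S)] <= permutations (enum S)}.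
    move=> _ /mapP[s sS ->]; rewrite mem_permutations; rewrite mem_enum in sS.
    by rewrite (perm_trans (perm_eq_map_perm_on uw sS)) // perm_sym.
  apply: uniq_perm => //; first exact: permutations_uniq.
  apply: (uniq_min_size u1 sub _).2.
  by rewrite size_map size_permutations ?enum_uniq // -!cardE card_perm.
rewrite -(perm_big _ pS) /= big_map big_enum /=.
apply: eq_bigr => s _; congr (_ *: _).
by elim: w {uw S sw pS} => [|j w IHw] /=; rewrite ?big_nil // !big_cons IHw.
Qed.

End Permutations.

(** * Expansion of weighted determinants into q-minors *)

Section DeterminantExpansion.
Variables (K : fieldType) (m : nat) (q : K).
Local Notation series := (ncseries K ('I_m * 'I_m)%type).
Local Notation p := (q^-1).
Local Notation gen x y := (gen_mx K m x y).
Implicit Types f : series.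

Lemma qweightD f1 f2 : qweight q (f1 + f2) = qweight q f1 + qweight q f2.
Proof. by apply/ncseriesP => w /=; rewrite mulrDr. Qed.

Lemma qweightN f : qweight q (- f) = - qweight q f.
Proof. by apply/ncseriesP => w /=; rewrite mulrN. Qed.

Lemma qweightZ k f : qweight q (k *: f) = k *: qweight q f.
Proof. by apply/ncseriesP => w /=; rewrite mulrCA. Qed.

Lemma qweight_sum (I : Type) (r : seq I) (P : pred I) (F : I -> series) :
  qweight q (\sum_(i <- r | P i) F i) = \sum_(i <- r | P i) qweight q (F i).
Proof.
apply: (big_morph _ qweightD); apply/ncseriesP => w /=; exact: mulr0.
Qed.

Lemma prod_ncvar (L : eqType) (z w : seq L) :
  (\prod_(x <- z) ncvar K x) w = (w == z)%:R.
Proof.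
elim: z w => [|x z IHz] w; first by rewrite big_nil /=; case: w.
rewrite big_cons; case: w => [|y w]; first by rewrite [LHS]ncmul_nil /= mul0r.
rewrite [LHS]ncmul_cons /= mul0r add0r.
have [->|yx] := eqVneq y x; last first.
  rewrite big1 => [|k _]; last by rewrite eqseq_cons (negbTE yx) mul0r.
  by rewrite eqseq_cons (negbTE yx).
rewrite big_ord_recl /= take0 eqxx mul1r drop0 IHz eqseq_cons eqxx /=.
rewrite big1 ?addr0 // => k _; rewrite eqseq_cons eqxx /=.
by case: w k => [|a w] [] //= k; rewrite ?mul0r.
Qed.

Lemma qweight_monomial (z : seq ('I_m * 'I_m)) :
  qweight q (\prod_(x <- z) gen x.1 x.2) =
  q ^ ((inv_word (unzip2 z))%:Z - (inv_word (unzip1 z))%:Z) *: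
    \prod_(x <- z) gen x.1 x.2.
Proof.
have -> : \prod_(x <- z) gen x.1 x.2 = \prod_(x <- z) ncvar K x.
  by apply: eq_bigr => -[x y] _; rewrite mxE.
apply/ncseriesP => w /=; rewrite prod_ncvar.
by case: eqP => [->|]; rewrite ?mulr0.
Qed.

Section Labels.
Variables (N : nat) (rho kappa : 'I_N -> 'I_m).
Hypotheses (rhoP : {mono rho : x y / (x < y)%N})
  (kappaP : {mono kappa : x y / (x < y)%N}).
Local Notation g := (fun x y => gen (rho x) (kappa y)).
Local Notation ltI := (fun x y : 'I_N => (x < y)%N).

Lemma signr_scale k f : (-1) ^+ k * f = (-1) ^+ k *: f.
Proof. by rewrite -signr_odd mulr_sign -signr_odd scaler_sign. Qed.

(** The column word is increasing, so the weight is [p] to the number of inversions of the row word,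
    and it merges with the sign. *)
Lemma qweight_perm_monomial (w : seq 'I_N) (s : 'S_N) : sorted ltI w ->
  (-1) ^+ inv_word (map s w) *: qweight q (\prod_(j <- w) g (s j) j) =
  (- p) ^+ inv_word (map s w) *: \prod_(j <- w) g (s j) j.
Proof.
move=> sw; pose z := [seq (rho (s j), kappa j) | j <- w].
have -> : \prod_(j <- w) g (s j) j = \prod_(x <- z) gen x.1 x.2 by rewrite big_map.
have -> := qweight_monomial z; rewrite /unzip1 /unzip2 -!map_comp.
have -> : inv_word [seq kappa j | j <- w] = 0%N.
  by rewrite inv_word_map // inv_word_sorted.
rewrite (map_comp rho s) inv_word_map // sub0r scalerA -exprz_inv -exprMn.
by rewrite mulN1r.
Qed.

(* The columns in L2 carry a diagonal term 1; those in w1 and e do not. *)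
Lemma qdet_expansion (w1 L2 e : seq 'I_N) : sorted ltI (w1 ++ L2 ++ e) ->
  \sum_(s : 'S_N | perm_on [set x in w1 ++ L2 ++ e] s)
    (-1) ^+ inv_word (map s (w1 ++ L2 ++ e)) *:
      qweight q (\prod_(j <- w1) g (s j) j *
        (\prod_(j <- L2) ((s j == j)%:R - g (s j) j) * \prod_(j <- e) g (s j) j)) =
  subseq_sum (fun u => (-1) ^+ size u *
    qminor q g [set x in w1 ++ u ++ e] (w1 ++ u ++ e)) L2.
Proof.
have tr : transitive ltI by move=> y x z; apply: ltn_trans.
elim: L2 w1 => [|k L2 IHL] w1 sw.
  rewrite /= mul1r qminor_perm; last first.
    by apply: (sorted_uniq tr) sw => x; rewrite /= ltnn.
  apply: eq_bigr => s _; rewrite big_nil mul1r -big_cat.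
  exact: qweight_perm_monomial.
rewrite subseq_sum_cons -IHL; last first.
  by apply: (subseq_sorted tr) sw; rewrite cat_subseq //; apply: subseq_cons.
(* For the subsequences that keep [k], the column [k] joins [w1] and contributes one sign, that of
   the entry [- g (s k) k]. *)
have -> : subseq_sum (fun u => (-1) ^+ size (k :: u) *
      qminor q g [set x in w1 ++ (k :: u) ++ e] (w1 ++ (k :: u) ++ e)) L2 =
    - subseq_sum (fun u => (-1) ^+ size u *
      qminor q g [set x in rcons w1 k ++ u ++ e] (rcons w1 k ++ u ++ e)) L2.
  rewrite -[RHS]mulN1r mulr_subseq_sum; apply: eq_subseq_sum => u _.
  by rewrite exprS -mulrA /= cat_rcons.
rewrite -IHL ?cat_rcons // -sumrN.
have kS : k \notin [set x in w1 ++ L2 ++ e].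
  have := sorted_uniq tr (fun x => ltnn x) sw.
  by rewrite inE -[_ ++ _ :: _]/(w1 ++ [:: k] ++ (L2 ++ e)) uniq_catCA => /andP[].
have Sk : [set x in w1 ++ (k :: L2) ++ e] = k |: [set x in w1 ++ L2 ++ e].
  by apply/setP => x; rewrite !inE !mem_cat !inE -!orbA orbCA.
(* The permutations of the labels other than [k] become those of all labels that fix [k]; they
   account for the term 1 of column [k], which is zero unless [s k = k]. *)
rewrite Sk; under [X in _ = X + _]eq_bigl => s do rewrite -(perm_on_fix _ kS).
rewrite [X in _ = X + _]big_mkcondr -big_split; apply: eq_bigr => s sS /=.
rewrite [in LHS]big_cons !mulrBl mulrBr qweightD qweightN scalerDr scalerN.
congr (_ - _); last by rewrite -cats1 big_cat big_seq1 !mulrA.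
case: eqP => [sk|_]; last first.
  by rewrite !mul0r mulr0 -(scale0r 0) qweightZ !scale0r scaler0.
(* Dropping a fixed point changes the number of inversions by an even amount, so the signs agree. *)
rewrite mul1r -signr_odd -[in RHS]signr_odd; congr (_ ^+ _ *: _).
by rewrite sign_inv_word_fix // -[k :: L2 ++ e]/((k :: L2) ++ e) Sk.
Qed.
End Labels.
End DeterminantExpansion.

(** * Change of labels and images under algebra morphisms *)

Section Relabelling.
Variables (K : fieldType) (A : algType K) (q : K).

Lemma mono_ltn_inj N m (h : 'I_N -> 'I_m) :
  {mono h : x y / (x < y)%N} -> injective h.
Proof.
by move=> hm x y hxy; apply/val_inj; case: (ltngtP x y) => // xy;
   rewrite -hm hxy ltnn in xy.
Qed.

(** The exponents depend on the order of the rows alone, which [rho] preserves. Separate row and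
    column labels serve the bordered matrix. *)
Lemma qminor_relabel N m (a : 'I_m -> 'I_m -> A) (rho kappa : 'I_N -> 'I_m) S J :
    {mono rho : x y / (x < y)%N} ->
  qminor q (fun x y => a (rho x) (kappa y)) S J =
    qminor q a [set rho x | x in S] (map kappa J).
Proof.
move=> rhoP; have rhoI := mono_ltn_inj rhoP.
elim: J S => [|j J IHJ] S /=; first by rewrite imset_eq0.
rewrite big_imset; last by move=> x y _ _; apply: rhoI.
apply: eq_bigr => x xS; rewrite IHJ.
have -> : before (rho @: S) (rho x) = before S x.
  apply/esym; rewrite /before -(card_imset _ rhoI); apply: eq_card => y; rewrite inE.
  apply/imsetP/andP => [[z + ->]|[/imsetP[z zS ->] zx]].
    by rewrite inE => /andP[zS zx]; rewrite rhoP imset_f.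
  by exists z; rewrite // inE zS -rhoP.
congr (_ *: (_ * qminor q a _ _)); apply/setP => y; rewrite !inE.
apply/imsetP/andP => [[z + ->]|[yx /imsetP[z zS yE]]].
  by rewrite !inE => /andP[zx zS]; rewrite (inj_eq rhoI) imset_f.
by exists z; rewrite // !inE zS andbT; apply: contraNneq yx => <-; rewrite yE.
Qed.

Lemma subseq_sum_map (I I' : Type) (V : nmodType) (h : I -> I') (f : seq I' -> V) s :
  subseq_sum f (map h s) = subseq_sum (fun w => f (map h w)) s.
Proof. by elim: s f => //= x s IHs f; rewrite !IHs. Qed.

Lemma qminor_morph m (P : algType K) (f : {lrmorphism A -> P})
    (a : 'I_m -> 'I_m -> A) S J :
  f (qminor q a S J) = qminor q (fun x y => f (a x y)) S J.
Proof.
elim: J S => [|j J IHJ] S /=; first by rewrite rmorph_nat.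
rewrite linear_sum; apply: eq_bigr => x _; rewrite linearZ -IHJ.
by congr (_ *: _); apply: (rmorphM f).
Qed.

Lemma subseq_sum_morph (I : Type) (V W : nmodType) (f : V -> W)
    (F : seq I -> V) s : {morph f : x y / x + y} ->
  f (subseq_sum F s) = subseq_sum (fun w => f (F w)) s.
Proof. by move=> fD; elim: s F => //= x s IHs F; rewrite fD !IHs. Qed.

Lemma principal_sum_morph m (P : algType K) (f : {lrmorphism A -> P})
    (a : 'I_m -> 'I_m -> A) L :
  f (principal_sum q a L) = principal_sum q (fun x y => f (a x y)) L.
Proof.
rewrite /principal_sum (subseq_sum_morph _ _ (rmorphD f)); apply: eq_subseq_sum => w _.
by rewrite rmorphM rmorphXn rmorphN1; congr (_ * _); apply: qminor_morph.
Qed.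

Lemma bordered_sum_morph m (P : algType K) (f : {lrmorphism A -> P})
    (a : 'I_m -> 'I_m -> A) L i j :
  f (bordered_sum q a L i j) = bordered_sum q (fun x y => f (a x y)) L i j.
Proof.
rewrite /bordered_sum (subseq_sum_morph _ _ (rmorphD f)); apply: eq_subseq_sum => w _.
by rewrite rmorphM rmorphXn rmorphN1; congr (_ * _); apply: qminor_morph.
Qed.

End Relabelling.

(** * Increasing lists of labels and subsets *)

Section Enumerations.
Variable m : nat.
Local Notation ltI := (fun x y : 'I_m => (x < y)%N).

Lemma ltI_trans : transitive ltI.
Proof. by move=> y x z; apply: ltn_trans. Qed.

Lemma ltI_irr : irreflexive ltI.
Proof. by move=> x; rewrite /= ltnn. Qed.

Lemma sorted_enum_ord : sorted ltI (enum 'I_m).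
Proof. by have := iota_ltn_sorted 0 m; rewrite -val_enum_ord sorted_map. Qed.

Lemma sorted_enum (S : {set 'I_m}) : sorted ltI (enum S).
Proof.
rewrite /enum_mem -enumT; apply: (sorted_filter ltI_trans).
exact: sorted_enum_ord.
Qed.

(** Links the recursive sums to the sum over sets of labels that defines [qdet_one_minus]. *)
Lemma subseq_sum_subsets (V : nmodType) (f : seq 'I_m -> V) L : sorted ltI L ->
  subseq_sum f L = \sum_(J : {set 'I_m} | J \subset [set x in L]) f (enum J).
Proof.
elim: L f => [|x L IHL] f sL /=.
  rewrite set_nil (big_pred1 set0) ?enum_set0 // => J.
  by rewrite subset0.
move: (sL) => /=; rewrite path_sortedE; last exact: ltI_trans.
case/andP=> /allP xL sL'; have xnL : x \notin [set y in L].
  by rewrite inE; apply/negP => /xL; rewrite ltnn.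
rewrite !IHL // set_cons addrC [RHS](bigID (fun J : {set 'I_m} => x \in J)) /=.
congr (_ + _).
  rewrite [RHS](reindex_onto (fun J => x |: J) (fun J => J :\ x)) /=; last first.
        by move=> J /andP[_ xJ]; rewrite setD1K.
  apply: eq_big => [J|J JL].
    rewrite setU11 andbT; apply/idP/andP => [JL|[JL /eqP <-]].
      by rewrite setUS // setU1K // (contra _ xnL) // => /(subsetP JL).
    by rewrite subDset.
  congr f; apply: (irr_sorted_eq ltI_trans ltI_irr); rewrite ?sorted_enum //=.
    rewrite path_sortedE ?sorted_enum ?andbT; last exact: ltI_trans.
    by apply/allP => y; rewrite mem_enum => /(subsetP JL); rewrite inE => /xL.
  by move=> y; rewrite inE !mem_enum !inE.
apply: eq_bigl => J; apply/idP/andP => [JL|[JL xJ]].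
  split; first by apply: subset_trans JL (subsetUr _ _).
  by apply: contra xnL => /(subsetP JL).
apply/subsetP => y yJ; have := subsetP JL y yJ; rewrite in_setU1.
by case/predU1P => // yx; rewrite -yx yJ in xJ.
Qed.

End Enumerations.

(** * The determinants of the theorem as principal and bordered sums *)

Section Determinants.
Variables (K : fieldType) (m : nat) (q : K).
Local Notation series := (ncseries K ('I_m * 'I_m)%type).
Local Notation gen := (fun x y => gen_mx K m x y).

Lemma qdetE N (B : 'M[series]_N) :
  qdet q B = \sum_(s : 'S_N | perm_on [set x in enum 'I_N] s)
    (-1) ^+ inv_word (map s (enum 'I_N)) *:
      qweight q (\prod_(k <- enum 'I_N) B (s k) k).
Proof.
rewrite /qdet qweight_sum; apply: eq_big => [s|s _].
  by apply/esym/subsetP => x _; rewrite inE mem_enum.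
by rewrite signr_scale qweightZ [index_enum _]unlock -enumT.
Qed.

Lemma qdet_principal N (B : 'M[series]_N) (h : 'I_N -> 'I_m) :
    {mono h : x y / (x < y)%N} ->
    (forall i j, B i j = (i == j)%:R - gen (h i) (h j)) ->
  qdet q B = principal_sum q gen (map h (enum 'I_N)).
Proof.
move=> hP BE; have := qdet_expansion q hP hP (w1 := [::]) (L2 := enum 'I_N) (e := [::]).
rewrite cats0 => /(_ (sorted_enum_ord N)); rewrite qdetE.
under eq_bigr => s _ do rewrite !big_nil mul1r mulr1.
under [X in _ -> X = _]eq_bigr => s _ do under eq_bigr => j _ do rewrite BE.
move->; rewrite /principal_sum subseq_sum_map; apply: eq_subseq_sum => w _.
rewrite /= cats0 (qminor_relabel _ gen _ _ _ hP) size_map; congr (_ * qminor _ _ _ _).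
by apply/setP => x; rewrite inE; apply/imsetP/mapP => -[y yw ->]; exists y;
   rewrite // inE in yw *.
Qed.

Section Bordered.
Variables (n : nat) (le_nm : (n <= m)%N).

(** The last column has no term 1, so it belongs to every word: it forms the list [e] of the
    expansion. Its entries carry a minus sign, which becomes the sign in front. *)
Lemma qdet_bordered (i j : 'I_m) : (n <= i)%N -> (n <= j)%N ->
  qdet q (bordered_mx K le_nm i j) =
    - bordered_sum q gen (map (widen_ord le_nm) (enum 'I_n)) i j.
Proof.
move=> ni nj.
(* Rows are labelled by [lab i] and columns by [lab j]; both are increasing because the last
   position receives a label that is at least [n]. *)
pose lab (l : 'I_m) (k : 'I_(n + 1)) :=
  if split k is inl k' then widen_ord le_nm k' else l.
have labP (l : 'I_m) : (n <= l)%N -> {mono lab l : x y / (x < y)%N}.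
  move=> nl x y; rewrite /lab.
  case: (split_ordP x) => x' ->; case: (split_ordP y) => y' -> //=.
  - by rewrite !ord1 addn0 !ltn_ord (leq_trans _ nl).
  - by rewrite !ord1 addn0 ltnNge (leq_trans (ltnW (ltn_ord _)) nl) ltnNge ltnW.
  - by rewrite !ord1 !ltnn.
have labl l k : lab l (lshift 1 k) = widen_ord le_nm k.
  by rewrite /lab (unsplitK (inl k)).
have labr l k : lab l (rshift n k) = l by rewrite /lab (unsplitK (inr k)).
have enumE : enum 'I_(n + 1) = map (lshift 1) (enum 'I_n) ++ [:: rshift n ord0].
  apply: (inj_map val_inj); rewrite val_enum_ord map_cat -map_comp /= addn0.
  by rewrite iotaD -val_enum_ord.
have := qdet_expansion q (labP i ni) (labP j nj) (w1 := [::])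
  (L2 := map (lshift 1) (enum 'I_n)) (e := [:: rshift n ord0]).
rewrite cat0s -enumE => /(_ (sorted_enum_ord _)) E.
rewrite qdetE -[LHS]opprK -[LHS]/(- - _); congr (- _).
transitivity (\sum_(s : 'S_(n + 1) | perm_on [set x in enum 'I_(n + 1)] s)
    (-1) ^+ inv_word (map s (enum 'I_(n + 1))) *:
      qweight q (\prod_(j0 <- [::]) gen (lab i (s j0)) (lab j j0) *
        (\prod_(j0 <- map (lshift 1) (enum 'I_n))
           ((s j0 == j0)%:R - gen (lab i (s j0)) (lab j j0)) *
         \prod_(j0 <- [:: rshift n ord0]) gen (lab i (s j0)) (lab j j0)))).
  rewrite -sumrN; apply: eq_bigr => s _; rewrite -scalerN -qweightN.
  congr (_ *: qweight q _).
  rewrite big_nil mul1r enumE big_cat !big_seq1 -mulrN; congr (_ * _).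
    rewrite !big_map; apply: eq_bigr => k _; rewrite /bordered_mx labl.
    case: (split_ordP (s (lshift 1 k))) => k' ->.
      rewrite block_mxEul !mxE labl (inj_eq (@lshift_inj _ _)) //.
    rewrite block_mxEdl !mxE labr eq_rlshift sub0r //.
  rewrite labr; case: (split_ordP (s (rshift n ord0))) => k' ->.
    by rewrite block_mxEur !mxE labl opprK.
  by rewrite block_mxEdr !mxE labr !ord1 eqxx mulr1n opprK.
rewrite E /bordered_sum [LHS]subseq_sum_map [RHS]subseq_sum_map.
apply: eq_subseq_sum => w _.
have mapw l : map (lab l) (map (lshift 1) w ++ [:: rshift n ord0]) =
    rcons (map (widen_ord le_nm) w) l.
  rewrite map_cat -map_comp cats1 /= labr; congr rcons.
  by apply: eq_map => k /=; rewrite labl.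
rewrite cat0s (qminor_relabel _ gen _ _ _ (labP i ni)) !size_map mapw.
congr (_ * qminor _ _ _ _); rewrite -mapw.
by apply/setP => x; rewrite inE; apply/imsetP/mapP => -[y yw ->]; exists y;
   rewrite // inE in yw *.
Qed.

End Bordered.

Lemma qdet_one_minusE n (c : 'I_m -> 'I_m -> series) :
  qdet_one_minus q n c = principal_sum q c (enum [set j : 'I_m | (n <= j)%N]).
Proof.
rewrite /principal_sum subseq_sum_subsets ?sorted_enum // /qdet_one_minus.
have setE (J : {set 'I_m}) : [set x in enum J] = J.
  by apply/setP => x; rewrite inE mem_enum.
rewrite setE; apply: eq_bigr => J _; rewrite -cardE; congr (_ * _).
have := qminor_perm q c (enum_uniq (mem J)); rewrite setE => ->.
by apply: eq_bigr => s _; rewrite -exprVn invrN.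
Qed.

End Determinants.

(** * The relations and the ideal they generate *)

Section RightQuantumQuotient.
Variables (K : fieldType) (m : nat) (q : K).
Hypothesis q_neq0 : q != 0.
Local Notation series := (ncseries K ('I_m * 'I_m)%type).
Local Notation gen := (fun x y => gen_mx K m x y).
Local Notation relations := (@right_quantum_relations K m q).

(** Up to the scalar [- q^-1], the first family of relations says that two-row minors with equal
    columns vanish; the second is the rule for exchanging two columns. *)
Lemma right_quantum_morph (P : algType K) (f : {lrmorphism series -> P}) T :
    (forall x, relations x -> f x = 0) ->
  right_quantum q (fun x y => f (gen x y)) T.
Proof.
move=> f0 S _ /eqP/cards2P[x [y [xy ->]]].
have fB u v : f (u - v) = f u - f v by exact: rmorphB.
have fM u v : f (u * v) = f u * f v by exact: rmorphM.
have fZ k u : f (k *: u) = k *: f u by exact: linearZ.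
wlog {xy} xy : x y / (x < y)%N => [IH|].
  by case: (ltngtP x y) xy => [/IH//|/IH|/val_inj->]; rewrite ?eqxx // setUC.
split=> [k _|k l _ _ kl]; rewrite !qminor_set2 //.
  have : f (gen y k * gen x k - q *: (gen x k * gen y k)) = 0.
    by apply: f0; left; exists x, y, k.
  rewrite fB fZ !fM => /subr0_eq ->.
  by rewrite scalerA mulVf // scale1r subrr.
have : f ((gen x k * gen y l - q^-1 *: (gen y k * gen x l))
           - (gen y l * gen x k - q *: (gen x l * gen y k))) = 0.
  by apply: f0; right; exists x, y, k, l.
rewrite !(fB, fZ, fM) => /subr0_eq ->.
by rewrite scaleNr scalerBr opprB scalerA divff // scale1r.
Qed.

Lemma closed_ideal_generated_ideal (L : Type) (S : ncseries K L -> Prop) :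
  two_sided_ideal (closed_ideal_generated S).
Proof.
split=> [I [I0 _ _] //|f g Sf Sg I tI cI SI|u f v Sf I tI cI SI].
  by have [_ ID _] := tI; apply: ID; [apply: Sf|apply: Sg].
by have [_ _ IM] := tI; apply: IM; apply: Sf.
Qed.

End RightQuantumQuotient.

(** * The identity modulo the closed ideal *)

Theorem right_quantum_sylvester (K : fieldType) (n m : nat) (q : K)
    (le_nm : (n <= m)%N) : q != 0 ->
  eq_modulo (right_quantum_relations q)
    ((qdet q (1%:M - A0_mx K le_nm))^-1 * qdet q (1%:M - gen_mx K m))
    (qdet_one_minus q n (cq q le_nm)).
Proof.
move=> q_neq0.
pose J := closed_ideal_generated (@right_quantum_relations K m q).
have [J0 JD JM] : two_sided_ideal J by apply: closed_ideal_generated_ideal.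
(* If the ideal contains 1, any two series are equal modulo it; otherwise the quotient is a nonzero
   algebra. *)
have [J1|J1] := pselect (J 1).
  by rewrite /eq_modulo -[_ - _]mulr1 -[_ * 1]mulr1; apply: JM.
have [P [f [fJ fsurj]]] := quotient_algebra J0 JD JM J1.
have fB u v : f (u - v) = f u - f v by exact: rmorphB.
have fM u v : f (u * v) = f u * f v by exact: rmorphM.
have f1 : f 1 = 1 by exact: rmorph1.
have fS (c : 'I_m -> 'I_m -> _) L : f (principal_sum q c L) = principal_sum q (fun x y => f (c x y)) L.
  exact: principal_sum_morph.
apply/fJ; rewrite fB fM; apply/eqP; rewrite subr_eq0; apply/eqP.
pose L0 := map (widen_ord le_nm) (enum 'I_n).
pose L1 := enum [set j : 'I_m | (n <= j)%N].
have L0n x : x \in L0 -> (x < n)%N by case/mapP => y _ ->; apply: (ltn_ord y).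
have L1n x : x \in L1 -> (n <= x)%N by rewrite mem_enum inE.
have sL : sorted (fun x y : 'I_m => (x < y)%N) (L0 ++ L1).
  rewrite (sorted_pairwise (@ltI_trans m)) pairwise_cat -!(sorted_pairwise (@ltI_trans m)).
  rewrite sorted_enum andbT; apply/andP; split.
    by apply/allrelP => x y /L0n xn /L1n; apply: leq_trans.
  by rewrite sorted_map; apply: (sorted_enum_ord n).
have LE : enum 'I_m = L0 ++ L1.
  apply: (irr_sorted_eq (@ltI_trans m) (@ltI_irr m) (sorted_enum_ord m) sL) => x.
  rewrite mem_enum mem_cat mem_enum !inE; case: (leqP n x) => [_|xn]; rewrite ?orbT //.
  rewrite orbF; apply/esym/mapP; exists (Ordinal xn); rewrite ?mem_enum //.
  exact/val_inj.
have d0 : qdet q (1%:M - A0_mx K le_nm) = principal_sum q (fun x y => gen_mx K m x y) L0.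
  by apply: qdet_principal => [x y|i j] //; rewrite !mxE mulrb.
have d1 : qdet q (1%:M - gen_mx K m) =
    principal_sum q (fun x y => gen_mx K m x y) (enum 'I_m).
  rewrite -[enum _ in RHS]map_id.
  by apply: qdet_principal => [x y|i j] //; rewrite !mxE mulrb.
have u0 := qdet_one_minus_A0_unit q le_nm.
have fV : f (qdet q (1%:M - A0_mx K le_nm))^-1 * f (qdet q (1%:M - A0_mx K le_nm)) = 1.
  by rewrite -fM mulVr.
(* The inverse is cancelled on the left: in [P], the determinant of [I - A] is to be that of
   [I - A_0] times that of [I - C^q]. *)
rewrite -[RHS]mul1r -fV -mulrA; congr (_ * _).
rewrite [X in f X = _]d1 [X in _ = f X * _]d0 [X in _ * f X]qdet_one_minusE.
rewrite !fS LE.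
(* Images of series with zero constant term; if [x] is such a series, [1 - x] has constant term 1
   and is a unit already before passing to the quotient. *)
pose N (y : P) := exists2 x : ncseries K _, f x = y & x [::] = 0.
apply: (q_sylvester q_neq0 (N := N)) => //.
- move=> _ _ [x <- x0] [y <- y0].
  by exists (x + y); rewrite ?rmorphD //= x0 y0 addr0.
- move=> x' _ [y <- y0]; have [x <-] := fsurj x'.
  by exists (x * y); rewrite ?fM // [LHS]ncmul_nil y0 mulr0.
- move=> _ [x <- x0].
  have ux : 1 - x \is a GRing.unit by rewrite unfold_in /= /ncunit /= x0 subr0 oner_eq0.
  exists (f (1 - x)^-1); rewrite -f1 -fB.
  by rewrite -!fM mulVr // mulrV.
- apply: right_quantum_morph => // x rx; apply/fJ => I _ _; exact.
- by move=> i j _ _; exists (gen_mx K m i j); rewrite // mxE.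
move=> i j /L1n ni /L1n nj.
have -> : bordered_sum q (fun x y => f (gen_mx K m x y)) L0 i j =
    f (bordered_sum q (fun x y => gen_mx K m x y) L0 i j).
  by apply/esym; apply: bordered_sum_morph.
rewrite -fS -d0 -fM; congr (f _).
(* The inverse in [cq] cancels, and its sign meets that of [qdet_bordered]. *)
by rewrite /cq mulrN mulrA mulrV // mul1r qdet_bordered // opprK.
Qed.

Theorem theorem8p3 (R : realType) (n m : nat) (q : R[i])
    (n_ge1 : (1 <= n)%N) (lt_nm : (n < m)%N) (q_neq0 : q != 0) :
  eq_modulo (right_quantum_relations q)
    ((qdet q (1%:M - A0_mx R[i] (ltnW lt_nm)))^-1 *
       qdet q (1%:M - gen_mx R[i] m))
    (qdet_one_minus q n (cq q (ltnW lt_nm))).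
Proof. exact: right_quantum_sylvester. Qed.
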